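(* Let $C_n$ be the cycle of order $n$, $n\geq 3$. Then $\mathrm{fgndi}_{\sum}(C_n)=3$ if $n=3$, and $\mathrm{fgndi}_{\sum}(C_n)=2$ if $n\geq 4$.
   Context: For a finite simple graph $G$ and an integer $k\ge 1$, a non-proper total $k$-coloring is an arbitrary map $f: V(G)\cup E(G)\rightarrow \{1,2,\dots,k\}$. Its weight function is $$\phi(x)=f(x)+\sum_{e\ni x}f(e)+\sum_{y\in N(x)}f(y)\quad (x\in V(G)),$$ where the first sum is over the edges $e$ incident with $x$ and $N(x)=\{y\in V(G): xy\in E(G)\}$. The coloring $f$ is called a neighbor full sum distinguishing (NFSD) total $k$-coloring if $\phi(x)\neq\phi(y)$ for every edge $xy\in E(G)$. The neighbor full sum distinguishing total chromatic number $\mathrm{fgndi}_{\sum}(G)$ is the smallest $k$ for which $G$ has an NFSD total $k$-coloring. *)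

(* Defs.v *)
From mathcomp Require Import all_boot.

Set Implicit Arguments.
Unset Strict Implicit.
Unset Printing Implicit Defensive.

Record sgraph := SGraph {
  vertex :> finType;
  adj : rel vertex;
  adj_sym : symmetric adj;
  adj_irrefl : irreflexive adj }.

Definition edge_set (G : sgraph) : {set {set G}} :=
  [set [set p.1; p.2] | p : G * G & adj p.1 p.2].

Definition edge (G : sgraph) := {e : {set G} | e \in edge_set G}.

(* A total colouring is a map on the disjoint union V(G) + E(G). *)
Definition total_coloring (G : sgraph) (k : nat) (f : G + edge G -> nat) : Prop :=
  forall z, 1 <= f z <= k.

Definition weight (G : sgraph) (f : G + edge G -> nat) (x : G) : nat :=
  f (inl x) + \sum_(e : edge G | x \in val e) f (inr e)
            + \sum_(y : G | adj x y) f (inl y).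

Definition nfsd_coloring (G : sgraph) (k : nat) (f : G + edge G -> nat) : Prop :=
  total_coloring k f /\
  forall x y : G, adj x y -> weight f x <> weight f y.

Definition nfsd_colorable (G : sgraph) (k : nat) : Prop :=
  exists f : G + edge G -> nat, nfsd_coloring k f.

(* "fgndi(G) = k".  A relation rather than a function, because some graphs
   (for instance K_2) have no NFSD total k-colouring for any k. *)
Definition fgndi_eq (G : sgraph) (k : nat) : Prop :=
  [/\ 1 <= k, nfsd_colorable G k
    & forall j, 1 <= j -> nfsd_colorable G j -> k <= j].

(* [ordS i] is i + 1 modulo n.  The conjunct [i != j] is automatic for n >= 2
   and only serves to keep the relation irreflexive when n = 1. *)
Definition cycle_adj (n : nat) : rel 'I_n :=
  fun i j => (i != j) && ((j == ordS i) || (i == ordS j)).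

Lemma cycle_adj_sym n : symmetric (@cycle_adj n).
Proof. by move=> i j; rewrite /cycle_adj eq_sym orbC. Qed.

Lemma cycle_adj_irrefl n : irreflexive (@cycle_adj n).
Proof. by move=> i; rewrite /cycle_adj eqxx. Qed.

Definition cycle_graph (n : nat) : sgraph :=
  SGraph (@cycle_adj_sym n) (@cycle_adj_irrefl n).

(* Main.v *)
Require Import Defs.
From mathcomp Require Import all_boot.
From mathcomp Require Import zify.

(** On a cycle with vertices v_i and edges e_i = v_i v_(i+1), the weight of v_i
    is f(v_(i-1)) + f(v_i) + f(v_(i+1)) + f(e_(i-1)) + f(e_i).  Two consecutive
    weights share most of their terms, and after cancellation the weights of
    v_(i+1) and v_(i+2) differ if and only if

      f(v_i) + f(e_i) <> f(v_(i+3)) + f(e_(i+2))          (1)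

    ([nfsd_cycleP]).  Everything is read off this condition.

    Lower bounds.  With a single colour both sides of (1) equal 2, so at least
    two colours are needed ([cycle_nfsd_gt1]).  On the triangle v_(i+3) = v_i,
    so (1) says that the three edges get pairwise distinct colours, and three
    colours are needed ([triangle_nfsd_gt2]); conversely any such colouring of
    the edges works ([nfsd_triangle_coloring]).

    Two colours suffice for n >= 4.  Colour v_i by the parity of i.  As i and
    i+3 have opposite parities, (1) holds with a constant edge colouring, except
    possibly where i+3 wraps around.  If n is even, reduction modulo n keeps
    parities and nothing has to be repaired.  If n is odd, the three wrapping
    conditions i = n-3, n-2, n-1 fail, and giving the other colour to the two
    edges at v_0 repairs them all: these edges are e_(n-1) and e_0, which occur
    on the right of (1) for i = n-3 and i = n-2, and e_(n-1) occurs on the left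
    for i = n-1.  The remaining condition concerned is i = 0, where lowering
    f(e_0) only widens the gap ([nfsd_cycle_coloring]). *)

Set Implicit Arguments.
Unset Strict Implicit.
Unset Printing Implicit Defensive.

(** * Edges as pairs of neighbours *)

(** Edge colours as a function of two vertices, so that the edges at a vertex
    can be indexed by its neighbours; 0 is a dummy value off the edges. *)
Definition edge_color (G : sgraph) (f : G + edge G -> nat) (x y : G) : nat :=
  if insub [set x; y] is Some e then f (inr (e : edge G)) else 0.

Lemma edge_color_sym (G : sgraph) (f : G + edge G -> nat) (x y : G) :
  edge_color f x y = edge_color f y x.
Proof. by rewrite /edge_color setUC. Qed.

Lemma edge_set2 (G : sgraph) (x y : G) :
  adj x y -> [set x; y] \in edge_set G.
Proof. by move=> xy; apply/imsetP; exists (x, y); rewrite ?inE. Qed.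

Lemma edge_colorP (G : sgraph) (f : G + edge G -> nat) (x y : G) :
  adj x y ->
  exists2 e : edge G, val e = [set x; y] & edge_color f x y = f (inr e).
Proof.
move=> /edge_set2 xy; exists (exist _ [set x; y] xy : edge G) => //.
by rewrite /edge_color insubT.
Qed.

Lemma incident_edgeP (G : sgraph) (x : G) (s : {set G}) :
  reflect (exists2 y, adj x y & s = [set x; y])
          ((s \in edge_set G) && (x \in s)).
Proof.
apply: (iffP andP) => [[/imsetP[[a b] /= ab ->]] | [y xy ->]]; last first.
  by rewrite edge_set2 // set21.
move: ab; rewrite !inE /= => ab /orP[] /eqP ->; first by exists b.
by exists a; [rewrite adj_sym | rewrite setUC].
Qed.

(** A vertex of a simple graph has exactly one incident edge per neighbour:
    [y |-> [set x; y]] is injective on the neighbours of [x]. *)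
Lemma sum_incident_edges (G : sgraph) (f : G + edge G -> nat) (x : G) :
  \sum_(e : edge G | x \in val e) f (inr e)
    = \sum_(y : G | adj x y) edge_color f x y.
Proof.
have inj : {in [set y | adj x y] &, injective (fun y => [set x; y])}.
  move=> y z; rewrite !inE => xy xz /setP/(_ y).
  rewrite !inE eqxx orbT => /esym/orP[]/eqP // yx.
  by rewrite yx adj_irrefl in xy.
pose F (s : {set G}) := if insub s is Some e then f (inr (e : edge G)) else 0.
transitivity (\sum_(s in [set [set x; y] | y in [set y | adj x y]]) F s).
  rewrite (reindex_omap (val : edge G -> {set G}) insub) /=.
    apply: eq_big => [e | e _]; last by rewrite /F valK.
    rewrite valK eqxx andbT; apply/idP/imsetP.
      move=> xe; have /incident_edgeP[y xy ->] := introT andP (conj (valP e) xe).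
      by exists y; rewrite ?inE.
    by case=> y _ ->; rewrite set21.
  move=> s /imsetP[y]; rewrite inE => /edge_set2 xy ->.
  by rewrite insubT /=.
by rewrite big_imset //; apply: eq_bigl => y; rewrite inE.
Qed.

(** * Weights on a cycle *)

Lemma modSn_mod a n : (a %% n).+1 %% n = a.+1 %% n.
Proof. by rewrite -addn1 modnDml addn1. Qed.

Lemma modn_add_neq n a k : a < n -> 0 < k < n -> (a + k) %% n != a.
Proof.
move=> a_lt k_lt; rewrite -[X in _ != X](modn_small a_lt) -[X in _ != X %% _]addn0.
by rewrite eqn_modDl mod0n modn_small; lia.
Qed.

Section Cycle.
Variable n : nat.
Hypothesis n_gt2 : 2 < n.
Implicit Types i j : 'I_n.

Lemma cycle_adjS i : cycle_adj i (ordS i).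
Proof.
rewrite /cycle_adj eqxx andbT eq_sym -val_eqE /= -addn1.
by apply: modn_add_neq => //; lia.
Qed.

(** This is where [n > 2] enters: it makes the two neighbours of a vertex
    distinct. *)
Lemma ordS_neq_ord_pred i : ordS i != ord_pred i.
Proof.
rewrite -(inj_eq (@ordS_inj n)) ord_predK -val_eqE /= modSn_mod -addn2.
by apply: modn_add_neq => //; lia.
Qed.

Lemma sum_cycle_adj (F : 'I_n -> nat) i :
  \sum_(j | cycle_adj i j) F j = F (ordS i) + F (ord_pred i).
Proof.
rewrite (bigD1 (ordS i)) ?cycle_adjS //=; congr addn.
apply: big_pred1 => j /=.
apply/andP/eqP => [[/andP[_ /orP[-> | /eqP ->]]] // | ->].
  by rewrite ordSK.
split; last by rewrite eq_sym ordS_neq_ord_pred.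
by rewrite cycle_adj_sym -[X in cycle_adj _ X]ord_predK cycle_adjS.
Qed.

Variable f : cycle_graph n + edge (cycle_graph n) -> nat.

Lemma cycle_weightE i :
  weight f i = f (inl i)
    + (edge_color f i (ordS i) + edge_color f (ord_pred i) i)
    + (f (inl (ordS i)) + f (inl (ord_pred i))).
Proof.
rewrite /weight sum_incident_edges !(sum_cycle_adj _ i).
by rewrite (@edge_color_sym (cycle_graph n) f i (ord_pred i)).
Qed.

(** The vertices [i+1] and [i+2] with the edge between them count in both
    weights, and cancel. *)
Lemma cycle_weight_eq i :
  (weight f (ordS i) == weight f (ordS (ordS i)))
    = (f (inl i) + edge_color f i (ordS i)
       == f (inl (ordS (ordS (ordS i))))
          + edge_color f (ordS (ordS i)) (ordS (ordS (ordS i)))).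
Proof. by rewrite !cycle_weightE !ordSK; lia. Qed.

(** Every edge of the cycle joins some [i+1] to [i+2], so the inequalities
    between neighbouring weights are all of the cancelled form. *)
Lemma nfsd_cycleP k :
  nfsd_coloring k f <->
  total_coloring k f /\
  forall i : 'I_n, f (inl i) + edge_color f i (ordS i)
            != f (inl (ordS (ordS (ordS i))))
               + edge_color f (ordS (ordS i)) (ordS (ordS (ordS i))).
Proof.
split=> -[fk fP]; split=> //.
  move=> i; rewrite -cycle_weight_eq.
  by apply/eqP/fP; apply: cycle_adjS.
move=> i j; suffices wS (l : 'I_n) : weight f l <> weight f (ordS l).
  by case/andP=> _ /orP[]/eqP->; [|apply: nesym]; apply: wS.
by rewrite -[l]ord_predK; apply/eqP; rewrite cycle_weight_eq fP.
Qed.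
End Cycle.

(** * Lower bounds *)

Lemma edge_color_bounds (G : sgraph) k (f : G + edge G -> nat) (x y : G) :
  total_coloring k f -> adj x y -> 1 <= edge_color f x y <= k.
Proof. by move=> fk /(edge_colorP f)[e _ ->]. Qed.

(** With one colour both sides of the condition of [nfsd_cycleP] are 2. *)
Lemma cycle_nfsd_gt1 n k :
  2 < n -> nfsd_colorable (cycle_graph n) k -> 1 < k.
Proof.
move=> n_gt2 [f /(nfsd_cycleP n_gt2)[fk fP]].
have i : 'I_n by exists 0; lia.
have := fP i.
have := edge_color_bounds fk (cycle_adjS n_gt2 i).
have := edge_color_bounds fk (cycle_adjS n_gt2 (ordS (ordS i))).
have := fk (inl i); have := fk (inl (ordS (ordS (ordS i)))).
by rewrite /=; lia.
Qed.

Lemma triangle_ordS3 (i : 'I_3) : ordS (ordS (ordS i)) = i.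
Proof. by apply: val_inj; case: i => [[|[|[|]]]]. Qed.

(** Since [i+3 = i] on the triangle, the vertex colours cancel in the condition
    of [nfsd_cycleP], which then forces three distinct edge colours. *)
Lemma triangle_nfsd_gt2 k : nfsd_colorable (cycle_graph 3) k -> 2 < k.
Proof.
case=> f /(nfsd_cycleP (isT : 2 < 3))[fk fP].
pose c (i : 'I_3) := edge_color f i (ordS i).
have c_bounds i : 1 <= c i <= k.
  exact/(edge_color_bounds fk)/cycle_adjS.
have cP i : c i != c (ordS (ordS i)).
  by have := fP i; rewrite {1}triangle_ordS3 eqn_add2l.
have := c_bounds ord0; have := c_bounds (ordS ord0).
have := c_bounds (ordS (ordS ord0)).
have := cP ord0; have := cP (ordS ord0); have := cP (ordS (ordS ord0)).
by rewrite !triangle_ordS3; lia.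
Qed.

(** * Optimal colourings *)

Definition triangle_coloring (z : cycle_graph 3 + edge (cycle_graph 3)) : nat :=
  match z with
  | inl _ => 1
  | inr e => if ord0 \notin val e then 1 else
             if ord_max \in val e then 2 else 3
  end.

(** Dually to [triangle_nfsd_gt2], distinct edge colours suffice; the vertices
    can all be coloured alike. *)
Lemma nfsd_triangle_coloring : nfsd_coloring 3 triangle_coloring.
Proof.
apply/(nfsd_cycleP (isT : 2 < 3)); split=> [[i | e] //= | i].
  by case: ifP => // _; case: ifP.
have cE (j : 'I_3) := edge_colorP triangle_coloring (cycle_adjS (isT : 2 < 3) j).
have [e1 e1E ->] := cE i; have [e2 e2E ->] := cE (ordS (ordS i)).
rewrite /= e1E e2E !inE.
by case: i {e1 e2 e1E e2E} => [[|[|[|]]]].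
Qed.

(** For odd order the parities do not alternate between the last vertex and 0;
    the two edges at 0 compensate for that. *)
Definition cycle_coloring m
    (z : cycle_graph m.+1 + edge (cycle_graph m.+1)) : nat :=
  match z with
  | inl i => 1 + odd (i : 'I_m.+1)
  | inr e => 1 + ~~ (odd m.+1 && (ord0 \in val e))
  end.

(** The cases below are the positions of [i+1], [i+2] and [i+3] relative to the
    point where the numbering wraps around. *)
Lemma nfsd_cycle_coloring m :
  2 < m -> nfsd_coloring 2 (@cycle_coloring m).
Proof.
move=> m_gt2; have n_gt2 : 2 < m.+1 by lia.
apply/(nfsd_cycleP n_gt2); split=> [[i | e] /= | i]; try by lia.
have cE (j : 'I_m.+1) := edge_colorP (@cycle_coloring m) (cycle_adjS n_gt2 j).
have [e1 e1E ->] := cE i; have [e2 e2E ->] := cE (ordS (ordS i)).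
rewrite /= e1E e2E !inE -!val_eqE /= => {cE e1 e2 e1E e2E}.
case: i => i /= i_lt; rewrite !(modSn_mod i.+1) !(modSn_mod i.+2).
(* The indices stay below twice the order, so each wraps at most once. *)
have modE a : a < m.+1 + m.+1 -> a %% m.+1 = if a < m.+1 then a else a - m.+1.
  case: (ltnP a m.+1) => [? _ | ge lt]; first exact: modn_small.
  by rewrite -{1}(subnK ge) modnDr modn_small; lia.
rewrite !modE; try lia.
by case: (ltnP i.+1 _); case: (ltnP i.+2 _); case: (ltnP i.+3 _); lia.
Qed.

Theorem proposition5 (n : nat) (hn : 3 <= n) :
  (n = 3 -> fgndi_eq (cycle_graph n) 3) /\
  (4 <= n -> fgndi_eq (cycle_graph n) 2).
Proof.
split=> [-> | n_gt3]; split=> //.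
- by exists triangle_coloring; apply: nfsd_triangle_coloring.
- by move=> j _; apply: triangle_nfsd_gt2.
- case: n n_gt3 {hn} => // m m_gt2.
  by exists (@cycle_coloring m); apply: nfsd_cycle_coloring.
- by move=> j _; apply: cycle_nfsd_gt1.
Qed.
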